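(* Let $x=(x_1,\dots,x_l)$ and $y=(y_1,\dots,y_l)$ be $l$-dimensional boxes (arrays of positive integers) with $x_i\ge y_i$ for all $i=1,\dots,l$. Let $X$ be the random variable that assigns to a result of aggregation $x+y\to z$ the number of indices $i$ with $z_i\ne x_i$. Then for $k=1,\dots,l$ the probability that a result of aggregation of $x$ and $y$ is longer than the original box $x$ in (exactly) $k$ directions is given by $$P(X=k)=\frac{2^k}{|T|}\left(R_k(x-y+1^l,\,y)-R_k(x-y+1^l,\,y-1^l)\right)$$ $$=\frac{2^k\prod_{i=1}^{l}(x_i-y_i+1)}{|T|}\left(E_k\!\left(\frac{y_1}{x_1-y_1+1},\dots,\frac{y_l}{x_l-y_l+1}\right)-E_k\!\left(\frac{y_1-1}{x_1-y_1+1},\dots,\frac{y_l-1}{x_l-y_l+1}\right)\right).$$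
   Context: An $l$-dimensional box $x=(x_1,\dots,x_l)\in\mathbb{Z}_{>0}^l$ is a Cartesian product of $l$ intervals parallel to the coordinate axes of $\mathbb{R}^l$, with integer side lengths $x_1,\dots,x_l$ (in this order) and with vertices in $\mathbb{Z}^l$. Attachments: keep the box $x$ in a fixed position and translate the box $y$ (without rotation) by lattice vectors. A position of $y$ is an attachment if the two boxes are placed next to each other (disjoint interiors) and their boundaries have at least one common lattice point. The result of the aggregation is the box $z=(z_1,\dots,z_l)$ given by the side lengths of the minimal axis-aligned bounding box of the union; one writes $x+y\to z$. All attachments are assumed equally likely. $|T|=\prod_{i=1}^{l}(x_i+y_i+1)-\prod_{i=1}^{l}(x_i+y_i-1)$ is the total number of attachments of $x$ and $y$. $1^l=(1,\dots,1)\in\mathbb{Z}^l$. For $a,b\in\mathbb{R}^l$, $$R_k(a,b)=\sum_{1\le i_1<\dots<i_k\le l}\ \prod_{j\notin\{i_1,\dots,i_k\}}a_j\prod_{j\in\{i_1,\dots,i_k\}}b_j .$$ $E_k(c_1,\dots,c_l)=\sum_{1\le i_1<\dots<i_k\le l}c_{i_1}\cdots c_{i_k}$ is the $k$-th elementary symmetric polynomial. *)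

(* Defs.v *)
From HB Require Import structures.
From mathcomp Require Export all_boot all_order all_algebra.
From mathcomp Require Export finmap.
From mathcomp Require Export all_classical all_reals all_analysis.
Export Order.TTheory GRing.Theory Num.Theory.
Export numFieldNormedType.Exports.

Set Implicit Arguments.
Unset Strict Implicit.
Unset Printing Implicit Defensive.


Local Open Scope classical_set_scope.
Local Open Scope ring_scope.

Section Boxes.
Context (R : realType) (l : nat).

Definition lattice_point (t : 'rV[int]_l) : 'rV[R]_l := map_mx intr t.

Definition box (a b : 'rV[R]_l) : set 'rV[R]_l :=
  [set p | forall i, a 0 i <= p 0 i <= b 0 i].

(* The box of side lengths s whose lowest vertex is the lattice point t. *)
Definition lattice_box (t : 'rV[int]_l) (s : 'I_l -> nat) : set 'rV[R]_l :=
  box (lattice_point t) (lattice_point t + \row_i (s i)%:R).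

Definition boundary (A : set 'rV[R]_l) : set 'rV[R]_l := closure A `\` A°.

(* The box x stays at the origin; a position of y is the translation vector t
   which is also its lowest vertex. *)
Definition is_attachment (x y : 'I_l -> nat) (t : 'rV[int]_l) : Prop :=
  (lattice_box 0 x)° `&` (lattice_box t y)° = set0 /\
  exists p : 'rV[int]_l,
    boundary (lattice_box 0 x) (lattice_point p) /\
    boundary (lattice_box t y) (lattice_point p).

Definition attachments (x y : 'I_l -> nat) : set 'rV[int]_l :=
  [set t | is_attachment x y t].

Definition is_bounding_box (A : set 'rV[R]_l) (a b : 'rV[R]_l) : Prop :=
  A `<=` box a b /\
  forall a' b' : 'rV[R]_l, A `<=` box a' b' -> box a b `<=` box a' b'.

Definition aggregates_to (x y : 'I_l -> nat) (t : 'rV[int]_l)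
    (z : 'I_l -> nat) : Prop :=
  exists a b : 'rV[R]_l,
    is_bounding_box (lattice_box 0 x `|` lattice_box t y) a b /\
    forall i, (z i)%:R = b 0 i - a 0 i.

(* The array z with x + y -> z at position t. It exists and is unique, so the
   default value x of xget plays no role. *)
Definition aggregate (x y : 'I_l -> nat) (t : 'rV[int]_l) : 'I_l -> nat :=
  xget x [set z | aggregates_to x y t z].

Definition num_longer (x y : 'I_l -> nat) (t : 'rV[int]_l) : nat :=
  #|[pred i | aggregate x y t i != x i]|.

(* Probability of the event E under the uniform law on a finite set Omega. *)
Definition equiprob (Omega E : set 'rV[int]_l) : R :=
  #|` fset_set (Omega `&` E)|%:R / #|` fset_set Omega|%:R.

Definition total_attachments (x y : 'I_l -> nat) : R :=
  \prod_(i < l) ((x i)%:R + (y i)%:R + 1) -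
  \prod_(i < l) ((x i)%:R + (y i)%:R - 1).

(* The index sets i_1 < ... < i_k are the k-element subsets S of 'I_l. *)
Definition Rsum (k : nat) (a b : 'I_l -> R) : R :=
  \sum_(S : {set 'I_l} | #|S| == k)
    (\prod_(j | j \notin S) a j) * \prod_(j in S) b j.

Definition Esym (k : nat) (c : 'I_l -> R) : R :=
  \sum_(S : {set 'I_l} | #|S| == k) \prod_(j in S) c j.

End Boxes.

(* Main.v *)
Require Import Defs.
From mathcomp Require Import zify ring lra.

(* A translation t is an attachment iff t lies in the product of the intervals
   [-y_i, x_i] but not in the product of their interiors, and then z_i <> x_i
   iff t_i < 0 or t_i > x_i - y_i. For a fixed set of k such directions, each
   of them offers 2 y_i choices of t_i in the closed interval and 2 (y_i - 1)
   in the open one, while each remaining direction offers x_i - y_i + 1 choices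
   in both. *)

Set Implicit Arguments.
Unset Strict Implicit.
Unset Printing Implicit Defensive.

Local Open Scope classical_set_scope.
Local Open Scope ring_scope.

(** * Interiors, boundaries and bounding boxes of real boxes *)

Section BoxTopology.
Context (R : realType) (l : nat).
Implicit Types a b c p : 'rV[R]_l.

Lemma interior_box a b :
  (box a b)° = [set p | forall i, a 0 i < p 0 i < b 0 i].
Proof.
apply/seteqP; split => p /= Hp.
  move=> i; move/nbhs_ballP: Hp => [e /= e0 He].
  (* Half the radius keeps the shifted point in the ball; shifting by [e / 2] and by [- (e / 2)]
     then makes both weak bounds strict. *)
  have He2 (s : R) : `|s| = e / 2 -> box a b (p + const_mx s).
    move=> sE; apply: He; split => // j k; rewrite /ball /= !mxE.
    rewrite opprD addNKr normrN sE; lra.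
  have e2 : `|e / 2| = e / 2 by rewrite ger0_norm; lra.
  have := He2 _ e2 i; have := He2 (- (e / 2)).
  rewrite normrN e2 => /(_ erefl i); rewrite !mxE; lra.
apply: (@filter_forall _ _ (fun i (q : 'rV[R]_l) => a 0 i <= q 0 i <= b 0 i)
  (nbhs p)) => i.
have /andP[ai bi] := Hp i.
have cv : (fun M : 'rV[R]_l => M 0 i) @ p --> p 0 i by exact: coord_continuous.
near=> q; apply/andP; split; apply: ltW; near: q.
  by apply: (cv [set s | a 0 i < s]); exact: lt_nbhsr.
by apply: (cv [set s | s < b 0 i]); exact: lt_nbhsl.
Unshelve. all: by end_near.
Qed.

Lemma closed_box a b : closed (box a b).
Proof.
rewrite (_ : box a b = \bigcap_(i in setT)
  ((fun M : 'rV[R]_l => M 0 i) @^-1` `[a 0 i, b 0 i]%classic)).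
  apply: closed_bigI => i _; apply: preimage_closed; last exact: itv_closed.
  by move=> q _; exact: coord_continuous.
apply/seteqP; split => p /=.
  by move=> Hp i _ /=; rewrite in_itv /= Hp.
by move=> Hp i; have := Hp i I; rewrite /= in_itv.
Qed.

Lemma boundary_box a b : boundary (box a b) = box a b `\` (box a b)°.
Proof. by rewrite /boundary -(closure_id _).1 //; exact: closed_box. Qed.

(** Inclusion need only be tested at the two extreme corners [a] and [b], which lie in the box by
    hypothesis. *)
Lemma box_subsetE a b a' b' : (forall i, a 0 i <= b 0 i) ->
  box a b `<=` box a' b' <-> forall i, a' 0 i <= a 0 i /\ b 0 i <= b' 0 i.
Proof.
move=> ab; split=> [sub i|sub p pab i]; last first.
  by have [? ?] := sub i; have := pab i; lra.
have [aa bb] : box a b a /\ box a b b by split=> j; rewrite lexx ab.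
by split; [have /andP[] := sub a aa i | have /andP[] := sub b bb i].
Qed.

(** A point of [A] makes both boxes nonempty, so their mutual inclusion determines the corners. *)
Lemma bounding_box_unique (A : set 'rV[R]_l) a b a' b' : A !=set0 ->
  is_bounding_box A a b -> is_bounding_box A a' b' -> a = a' /\ b = b'.
Proof.
move=> [p Ap] [Aab minab] [Aab' minab'].
have ab i : a 0 i <= b 0 i by have /(_ i) := Aab p Ap; lra.
have ab' i : a' 0 i <= b' 0 i by have /(_ i) := Aab' p Ap; lra.
have /(box_subsetE _ _ ab) sub := minab _ _ Aab'.
have /(box_subsetE _ _ ab') sub' := minab' _ _ Aab.
by split; apply/rowP => i; have [? ?] := sub i; have [? ?] := sub' i;
  apply/eqP; rewrite eq_le; apply/andP.
Qed.

Lemma bounding_box_setU a b c (d : 'rV[R]_l) :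
  (forall i, a 0 i <= b 0 i) -> (forall i, c 0 i <= d 0 i) ->
  is_bounding_box (box a b `|` box c d)
    (\row_i Num.min (a 0 i) (c 0 i)) (\row_i Num.max (b 0 i) (d 0 i)).
Proof.
move=> ab cd; split=> [p + i|a' b' sub].
  by rewrite !mxE ge_min le_max => -[] /(_ i)/andP[-> ->]; rewrite ?orbT.
apply/box_subsetE => i; rewrite !mxE.
  by rewrite ge_min !le_max ab.
have /(box_subsetE _ _ ab)/(_ i)[? ?] := subset_trans (@subsetUl _ _ _) sub.
have /(box_subsetE _ _ cd)/(_ i)[? ?] := subset_trans (@subsetUr _ _ _) sub.
by split; rewrite ?le_min ?ge_max; apply/andP.
Qed.

End BoxTopology.

(** * Attachments and aggregates in integer coordinates *)

Section Attachments.
Context (R : realType) (l : nat).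
Implicit Types (s x y : 'I_l -> nat) (t p : 'rV[int]_l).

Lemma lattice_boxP t s p : lattice_box t s (lattice_point R p) <->
  forall i, t 0 i <= p 0 i <= t 0 i + (s i)%:Z.
Proof.
have E i : ((lattice_point R t) 0 i <= (lattice_point R p) 0 i
    <= (lattice_point R t + \row_i (s i)%:R) 0 i) =
  (t 0 i <= p 0 i <= t 0 i + (s i)%:Z).
  by rewrite !mxE (pmulrn 1 (s i)) -intrD !ler_int.
by split=> H i; have := H i; rewrite ?E //= E.
Qed.

Lemma interior_lattice_boxP t s p :
  (lattice_box t s)° (lattice_point R p) <->
  forall i, t 0 i < p 0 i < t 0 i + (s i)%:Z.
Proof.
have E i : ((lattice_point R t) 0 i < (lattice_point R p) 0 i
    < (lattice_point R t + \row_i (s i)%:R) 0 i) =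
  (t 0 i < p 0 i < t 0 i + (s i)%:Z).
  by rewrite !mxE (pmulrn 1 (s i)) -intrD !ltr_int.
by rewrite interior_box; split=> H i; have := H i; rewrite ?E //= E.
Qed.

Lemma interior_lattice_boxes_disjoint x y t :
  (forall i, (0 < x i)%N) -> (forall i, (0 < y i)%N) ->
  (lattice_box 0 x : set 'rV[R]_l)° `&` (lattice_box t y)° = set0 <->
  exists i, t 0 i <= - (y i)%:Z \/ (x i)%:Z <= t 0 i.
Proof.
move=> x0 y0; rewrite /lattice_box !interior_box; split=> [disj|[i ti]].
  (* If no coordinate separates the boxes, their side intervals overlap in every coordinate; the
     midpoints of these overlaps form a point of both interiors. *)
  apply: contrapT => /forallNP nex; suff : set0 (\row_i ((Num.max 0 (t 0 i)%:~R
     + Num.min (x i)%:R ((t 0 i)%:~R + (y i)%:R)) / 2) : 'rV[R]_l) by [].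
  rewrite -disj; split=> i /=; rewrite !mxE;
    have /not_orP[/negP + /negP] := nex i;
    rewrite -!ltNge -!(ltr_int R) mulrNz -!pmulrn;
    have := x0 i; have := y0 i; rewrite -!(ltr_nat R);
    case: (leP 0 (t 0 i)%:~R);
    case: (leP (x i)%:R ((t 0 i)%:~R + (y i)%:R)); lra.
apply/seteqP; split=> // p [/(_ i) /= + /(_ i) /=]; rewrite !mxE.
move: ti; rewrite -!(ler_int R) mulrNz -!pmulrn; lra.
Qed.

(** A common point puts every [t_i] in the closed interval, and disjoint interiors put some [t_i]
    outside the open one. Conversely, in a coordinate where [t_i] is an endpoint the boxes only
    touch, so any common point lies on both boundaries. *)
Lemma is_attachmentP x y t :
  (forall i, (0 < x i)%N) -> (forall i, (0 < y i)%N) ->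
  is_attachment R x y t <->
  (forall i, - (y i)%:Z <= t 0 i <= (x i)%:Z) /\
  ~ (forall i, - (y i)%:Z < t 0 i < (x i)%:Z).
Proof.
move=> x0 y0; rewrite /is_attachment interior_lattice_boxes_disjoint //.
split=> [[[i ti] [p]]|[bd]].
  rewrite !boundary_box => -[[/lattice_boxP px _] [/lattice_boxP py _]].
  split=> [j|/(_ i)]; last by lia.
  by have := px j; have := py j; rewrite mxE; lia.
move=> /existsNP[i ti]; have bdi := bd i.
split; first by exists i; lia.
(* This is the lowest corner of the intersection of the two closed boxes. *)
exists (\row_j Num.max 0 (t 0 j)).
split; rewrite boundary_box; (split; [apply/lattice_boxP => j|
  move=> /interior_lattice_boxP/(_ i)]); rewrite !mxE; try (have := bd j); lia.
Qed.

(** Uniqueness of the bounding box fixes the value chosen by [xget]. The integer length is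
    nonnegative, so the absolute value only returns it to [nat]. *)
Lemma aggregateE x y t : aggregate R x y t = fun i =>
  `|(Num.max (x i)%:Z (t 0 i + (y i)%:Z) - Num.min 0 (t 0 i))%R|%N.
Proof.
have posw u (s : 'I_l -> nat) i : (lattice_point R u) 0 i <=
    (lattice_point R u + \row_i (s i)%:R) 0 i.
  by rewrite !mxE; have := ler0n R (s i); lra.
have bb := bounding_box_setU (posw 0 x) (posw t y).
have lengthE i : Num.max (x i)%:R ((t 0 i)%:~R + (y i)%:R) -
    Num.min 0%:~R (t 0 i)%:~R =
    `|(Num.max (x i)%:Z (t 0 i + (y i)%:Z) - Num.min 0 (t 0 i))%R|%:R :> R.
  rewrite natr_absz ger0_norm; last lia.
  rewrite !pmulrn -intrD !maxEle !minEle !ler_int.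
  by case: ifP; case: ifP; rewrite intrB.
apply: xget_unique => /=.
  by do 2 eexists; split; [exact: bb|move=> i; rewrite !mxE add0r lengthE].
move=> z [a [b [bb' zE]]].
have [|aE bE] := bounding_box_unique _ bb' bb.
  by exists (lattice_point R 0); left => i; rewrite lexx posw.
apply/funext => i; have := zE i; rewrite aE bE !mxE add0r lengthE.
by move/eqP; rewrite eqr_nat => /eqP.
Qed.

(** Side [i] grows by the overhang of [y] below [0] plus its overhang above [x_i]. *)
Lemma num_longerE x y t : (forall i, - (y i)%:Z <= t 0 i <= (x i)%:Z) ->
  (forall i, (y i <= x i)%N) ->
  num_longer R x y t =
  #|[pred i | (t 0 i < 0) || ((x i)%:Z - (y i)%:Z < t 0 i)]|.
Proof.
move=> bd yx; rewrite /num_longer aggregateE; apply: eq_card => i.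
by rewrite !inE; have := bd i; have := yx i; lia.
Qed.

End Attachments.

(** * Counting in finite types and identities for [Rsum] *)

Lemma card_interval (N a b : nat) : (b <= N)%N ->
  #|[pred c : 'I_N | (a <= c < b)%N]| = (b - a)%N.
Proof.
move=> bN; rewrite -sum1_card.
rewrite (eq_bigl (fun c : 'I_N => (a <= c < b)%N)) //.
rewrite -(big_mkord (fun c => (a <= c < b)%N) (fun=> 1%N)).
transitivity (\sum_(a <= c < b) 1)%N; last by rewrite sum_nat_const_nat muln1.
by rewrite (@big_nat_widenl _ _ addn a 0) // (@big_nat_widen _ _ _ 0 b N).
Qed.

Lemma card_fset_set_image (T : finType) (U : choiceType) (f : T -> U)
    (D : {pred T}) : injective f ->
  #|` fset_set (f @` [set` D])| = #|D|.
Proof.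
move=> finj; rewrite fset_set_image; last exact: finite_finpred.
rewrite card_imfset //= -card_finset; congr (#|` _|).
by apply/fsetP => c; rewrite in_fset_set ?in_fset ?mem_setE //.
Qed.

Lemma card_forall (I J : finType) (P : I -> pred J) :
  #|[pred f : {ffun I -> J} | [forall i, P i (f i)]]| = (\prod_i #|P i|)%N.
Proof.
rewrite (eq_card (B := family P)) ?card_family; last first.
  by move=> f; rewrite !inE.
by rewrite foldrE big_map big_enum.
Qed.

(** The functions are sorted by the set [S] of coordinates where [L] holds; once [S] is fixed, the
    coordinates are chosen independently. *)
Lemma card_forall_exactly (I J : finType) (P L : I -> pred J) (k : nat) :
  #|[pred f : {ffun I -> J} | [forall i, P i (f i)] &&
      (#|[pred i | L i (f i)]| == k)]| =
  (\sum_(S : {set I} | #|S| == k)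
    (\prod_(i | i \notin S) #|[pred c | P i c && ~~ L i c]|) *
     \prod_(i in S) #|[pred c | P i c && L i c]|)%N.
Proof.
rewrite -sum1_card.
rewrite (partition_big (fun f : {ffun I -> J} => [set i | L i (f i)]%SET)
  (fun S : {set I} => #|S| == k)) /=; last first.
  move=> f; rewrite inE => /andP[_ /eqP <-]; rewrite cardsE.
  by apply/eqP/eq_card => i; rewrite !inE.
apply: eq_bigr => S /eqP Sk.
rewrite mulnC.
(* Merging both products into one over all coordinates gives the form handled by [card_forall]. *)
have -> : (\prod_(i in S) #|[pred c | P i c && L i c]| *
  \prod_(i | i \notin S) #|[pred c | P i c && ~~ L i c]| =
  \prod_i #|[pred c | P i c && (L i c == (i \in S))]|)%N.
  rewrite [RHS](bigID (mem S)) /=; congr (_ * _)%N; apply: eq_bigr => i.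
    by move=> iS; apply: eq_card => c; rewrite !inE iS eqb_id.
  by move=> /negbTE iS; apply: eq_card => c; rewrite !inE iS eqbF_neg.
rewrite -card_forall -sum1_card; apply: eq_bigl => f; rewrite !inE.
apply/andP/forallP => [[/andP[/forallP Pf _] /eqP <-] i|Pf].
  by rewrite !inE Pf eqxx.
have SE : [set i | L i (f i)]%SET = S.
  by apply/setP => i; rewrite inE; have /andP[_ /eqP] := Pf i.
split; last by rewrite SE.
apply/andP; split; first by apply/forallP => i; have /andP[] := Pf i.
by rewrite -Sk -SE cardsE; apply/eqP/eq_card => i; rewrite !inE.
Qed.

(** Each term has exactly [k] factors from [b]. With [c = 2] this is the source of the factor
    [2 ^+ k]. *)
Lemma Rsum_mulr (R : realType) (l k : nat) (c : R) (a b : 'I_l -> R) :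
  Rsum k a (fun i => c * b i) = c ^+ k * Rsum k a b.
Proof.
rewrite mulr_sumr; apply: eq_bigr => S /eqP <-.
by rewrite big_split prodr_const mulrCA.
Qed.

Lemma Rsum_natr (R : realType) (l k : nat) (a b : 'I_l -> nat) :
  (\sum_(S : {set 'I_l} | #|S| == k)
    (\prod_(i | i \notin S) a i) * \prod_(i in S) b i)%N%:R =
  Rsum k (fun i => (a i)%:R) (fun i => (b i)%:R : R).
Proof.
by rewrite natr_sum; apply: eq_bigr => S _; rewrite natrM !natr_prod.
Qed.

(** Pulling out the full product of [a] adds the factors with index in [S], which the quotients
    cancel. *)
Lemma Rsum_Esym (R : realType) (l k : nat) (a b : 'I_l -> R) :
  (forall i, a i != 0) ->
  Rsum k a b = (\prod_i a i) * Esym k (fun i => b i / a i).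
Proof.
move=> a0; rewrite mulr_sumr; apply: eq_bigr => S _.
rewrite [in RHS](bigID (mem S)) /= [RHS]mulrAC -big_split /= [RHS]mulrC.
congr (_ * _).
by apply: eq_bigr => i _; rewrite mulrCA divff ?mulr1.
Qed.

(** * Counting attachments through functions into a finite ordinal type *)

Section Encoding.
Context (R : realType) (l : nat) (x y : 'I_l -> nat).
Hypotheses (x_gt0 : forall i, (0 < x i)%N) (y_gt0 : forall i, (0 < y i)%N).
Hypothesis le_yx : forall i, (y i <= x i)%N.

(** Exceeds every [x i + y i], so that a single ordinal type serves all directions. *)
Let N := (\max_i (x i + y i)).+1.

Let bound i : ((x i + y i) < N)%N.
Proof. by rewrite ltnS (leq_bigmax (F := fun i => x i + y i)%N). Qed.

(* f records t + y, whose entries lie in [0, x + y] at every attachment t. *)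
Let position (f : {ffun 'I_l -> 'I_N}) : 'rV[int]_l :=
  \row_i ((f i : nat)%:Z - (y i)%:Z).

(** In the shifted coordinate [c = t_i + y_i], these three predicates are the closed interval, the
    open interval and the condition [z_i <> x_i]. *)
Let outer i : pred 'I_N := fun c => (0 <= c < (x i + y i).+1)%N.
Let inner i : pred 'I_N := fun c => (1 <= c < x i + y i)%N.
Let longer i : pred 'I_N := fun c => ((c < y i) || (x i < c))%N.

Let position_inj : injective position.
Proof.
move=> f g /rowP fg; apply/ffunP => i; apply/val_inj.
by have := fg i; rewrite !mxE /=; lia.
Qed.

(** Attachments are the outer functions that are not inner, so any event is counted by a difference.
    Leaving [Q] free covers both the total count and the event of [k] longer directions. *)
Let card_attachmentsI (P : set 'rV[int]_l) (Q : pred {ffun 'I_l -> 'I_N}) :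
  (forall f : {ffun 'I_l -> 'I_N}, (forall i, outer i (f i)) ->
    P (position f) <-> Q f) ->
  #|` fset_set (attachments R x y `&` P)|%:R =
  #|[pred f : {ffun 'I_l -> 'I_N} | [forall i, outer i (f i)] && Q f]|%:R -
  #|[pred f : {ffun 'I_l -> 'I_N} | [forall i, inner i (f i)] && Q f]|%:R :> R.
Proof.
move=> PQ.
pose A := [pred f : {ffun 'I_l -> 'I_N} | [forall i, outer i (f i)] && Q f].
pose B := [pred f : {ffun 'I_l -> 'I_N} | [forall i, inner i (f i)]].
have -> : attachments R x y `&` P = position @` [set` [predD A & B]].
  apply/seteqP; split=> [t [/= /(is_attachmentP _ _ x_gt0 y_gt0)[bd nin] Pt]|].
    have tN i : (`|(t 0 i + (y i)%:Z)%R|%N < N)%N.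
      by have := bound i; have := bd i; lia.
    pose f : {ffun 'I_l -> 'I_N} := [ffun i => Ordinal (tN i)].
    have ft : position f = t.
      by apply/rowP => i; rewrite mxE ffunE /=; have := bd i; lia.
    have of_ i : outer i (f i) by rewrite /outer ffunE /=; have := bd i; lia.
    exists f => //; rewrite /= !inE; apply/and3P; split.
    - apply/negP => /forallP inf; apply: nin => i.
      by have := inf i; rewrite /inner ffunE /=; have := bd i; lia.
    - exact/forallP.
    - by apply/(PQ f of_); rewrite ft.
  move=> _ [f /= /and3P[/negP ninf /forallP of_ Qf] <-].
  split; last exact/(PQ f of_).
  apply/is_attachmentP => //; split=> [i|bd].
    by have := of_ i; rewrite /outer mxE; lia.
  apply: ninf; apply/forallP => i; have := bd i; rewrite /inner mxE; lia.
rewrite card_fset_set_image // -(cardID B A) natrD addrAC.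
suff -> : #|[predI A & B]| =
    #|[pred f : {ffun 'I_l -> 'I_N} | [forall i, inner i (f i)] && Q f]|.
  by rewrite subrr add0r.
apply: eq_card => f; rewrite !inE.
(* Inner functions are outer, so the intersection with [A] keeps all of them that satisfy [Q]. *)
case Bf : [forall i, inner i (f i)]; last by rewrite andbF.
suff -> : [forall i, outer i (f i)] by rewrite andbT.
apply/forallP => i; have /forallP/(_ i) := Bf => /andP[_ /ltnW].
by rewrite /outer ltnS.
Qed.

Let card_outer i : #|outer i| = (x i + y i).+1.
Proof. by rewrite -[RHS]subn0 -(@card_interval N). Qed.

Let card_inner i : #|inner i| = (x i + y i).-1.
Proof. by rewrite -subn1 -(@card_interval N) ?(ltnW (bound i)). Qed.

Let card_outer_short i :
  #|[pred c | outer i c && ~~ longer i c]| = (x i - y i).+1.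
Proof.
rewrite -subSn // -(@card_interval N); last by have := bound i; lia.
by apply: eq_card => c; rewrite !inE /outer /longer; lia.
Qed.

(** As [y_i] is positive, the values from [y_i] to [x_i] avoid both endpoints [0] and [x_i + y_i],
    so passing to the open interval loses none of them. *)
Let card_inner_short i :
  #|[pred c | inner i c && ~~ longer i c]| = (x i - y i).+1.
Proof.
rewrite -subSn // -(@card_interval N); last by have := bound i; lia.
apply: eq_card => c; rewrite !inE /inner /longer.
by have := y_gt0 i; lia.
Qed.

(** The long values form two intervals but their complement only one, hence the count by
    subtraction: [(x_i + y_i + 1) - (x_i - y_i + 1)]. *)
Let card_outer_long i : #|[pred c | outer i c && longer i c]| = (2 * y i)%N.
Proof.
have := cardID (longer i) (outer i); rewrite card_outer.
rewrite [X in (_ + X)%N](_ : _ = (x i - y i).+1); last first.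
  by rewrite -card_outer_short; apply: eq_card => c; rewrite !inE andbC.
have := le_yx i.
rewrite -[#|[predI _ & _]|]/#|[pred c | outer i c && longer i c]|; lia.
Qed.

Let card_inner_long i :
  #|[pred c | inner i c && longer i c]| = (2 * (y i).-1)%N.
Proof.
have := cardID (longer i) (inner i); rewrite card_inner.
rewrite [X in (_ + X)%N](_ : _ = (x i - y i).+1); last first.
  by rewrite -card_inner_short; apply: eq_card => c; rewrite !inE andbC.
have := le_yx i; have := y_gt0 i.
rewrite -[#|[predI _ & _]|]/#|[pred c | inner i c && longer i c]|; lia.
Qed.

(** The case of the trivial event: a direction offers [x_i + y_i + 1] outer and [x_i + y_i - 1]
    inner values. *)
Lemma card_attachments :
  #|` fset_set (attachments R x y)|%:R = total_attachments R x y.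
Proof.
rewrite -(setIT (attachments R x y)) (@card_attachmentsI _ predT) //.
rewrite /total_attachments.
rewrite (eq_card (B := [pred f : {ffun 'I_l -> 'I_N} |
  [forall i, outer i (f i)]])); last first.
  by move=> f; rewrite !inE andbT.
rewrite [X in _ - X%:R](eq_card (B := [pred f : {ffun 'I_l -> 'I_N} |
  [forall i, inner i (f i)]]));
  last by move=> f; rewrite !inE andbT.
rewrite !card_forall !natr_prod; congr (_ - _); apply: eq_bigr => i _.
  by rewrite card_outer -natr1 natrD.
have := y_gt0 i; rewrite card_inner -subn1 => yi.
by rewrite natrB ?natrD //; lia.
Qed.

Lemma card_longer_attachments k :
  let d := fun i => (x i)%:R - (y i)%:R + 1 : R in
  #|` fset_set (attachments R x y `&` [set t | num_longer R x y t = k])|%:R =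
  2 ^+ k * (Rsum k d (fun i => (y i)%:R) - Rsum k d (fun i => (y i)%:R - 1)).
Proof.
move=> d; rewrite (card_attachmentsI (Q := fun f =>
  #|[pred i | longer i (f i)]| == k)); last first.
  move=> f of_ /=; rewrite num_longerE //; last first.
    by move=> i; have := of_ i; rewrite /outer mxE; lia.
  rewrite (eq_card (B := [pred i | longer i (f i)])).
    by split => [->|/eqP].
  by move=> i; rewrite !inE mxE /longer; lia.
(* Absorbing [2 ^+ k] into each [Rsum] turns its second argument into the number of long values per
   direction. *)
rewrite !card_forall_exactly mulrBr -!Rsum_mulr.
have dE i : ((x i - y i).+1)%:R = d i by rewrite -natr1 natrB.
congr (_ - _).
  under eq_bigr do (under eq_bigr do rewrite card_outer_short;
    under [X in (_ * X)%N]eq_bigr do rewrite card_outer_long).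
  rewrite Rsum_natr; congr Rsum; apply/funext => i //.
  by rewrite natrM.
under eq_bigr do (under eq_bigr do rewrite card_inner_short;
  under [X in (_ * X)%N]eq_bigr do rewrite card_inner_long).
rewrite Rsum_natr; congr Rsum; apply/funext => i //.
by rewrite natrM -subn1 natrB.
Qed.

End Encoding.

Theorem proposition4p2 (R : realType) (l : nat) (x y : 'I_l -> nat)
    (x_gt0 : forall i, (0 < x i)%N) (y_gt0 : forall i, (0 < y i)%N)
    (le_yx : forall i, (y i <= x i)%N)
    (k : nat) (k_gt0 : (0 < k)%N) (le_kl : (k <= l)%N) :
  let d := fun i => (x i)%:R - (y i)%:R + 1 : R in
  let P := equiprob R (attachments R x y)
             [set t | num_longer R x y t = k] in
  P = 2 ^+ k / total_attachments R x y *
      (Rsum k d (fun i => (y i)%:R) - Rsum k d (fun i => (y i)%:R - 1))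
  /\
  2 ^+ k / total_attachments R x y *
      (Rsum k d (fun i => (y i)%:R) - Rsum k d (fun i => (y i)%:R - 1)) =
  2 ^+ k * \prod_(i < l) d i / total_attachments R x y *
      (Esym k (fun i => (y i)%:R / d i) -
       Esym k (fun i => ((y i)%:R - 1) / d i)).
Proof.
move=> d P.
(* Since [y i <= x i], [d i] is the successor of a natural number, so dividing by it is
   legitimate. *)
have d_neq0 i : d i != 0.
  by rewrite /d -natrB // natr1 pnatr_eq0.
split; last by rewrite !(Rsum_Esym _ _ d_neq0) -mulrBr; ring.
by rewrite /P /equiprob card_longer_attachments // card_attachments // mulrAC.
Qed.
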